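(* Let $\mathfrak M$ be a partial Steiner triple system and $m\ge 3$ an integer. The structure $\circledast^{m}\mathfrak M$ does not contain any miter-configuration.
   Context: A partial Steiner triple system (PSTS) is a structure $\mathfrak M=\langle S,\mathcal L\rangle$ with point set $S$ and a family $\mathcal L$ of 3-element subsets of $S$ (lines) such that any two distinct points lie on at most one line. Points are collinear if they lie on a common line. $C_m$ is the cyclic group of integers modulo $m$. For an integer $m\ge 3$, the $m$-weaved configuration $\circledast^{m}\mathfrak M$ has point set $S\times C_m$ and its lines are all the sets $\{(a,i),(b,i),(c,i+1)\}$ with $\{a,b,c\}\in\mathcal L$ (in any ordering of $a,b,c$) and $i\in C_m$; it is again a PSTS. In a PSTS, $p\circledcirc q$ is the partial operation: $p\circledcirc p=p$, and $p\circledcirc q=r$ when $\{p,q,r\}$ is a line. A triangle is a set of three pairwise collinear points not on one line. A triangle $\{a,b,c\}$ determines a miter configuration with center $a$ when the equality $a\circledcirc(b\circledcirc c)=(a\circledcirc b)\circledcirc(a\circledcirc c)$ holds (both sides being defined); the miter configuration then consists of the seven points $a,b,c,a\circledcirc b,a\circledcirc c,b\circledcirc c,a\circledcirc(b\circledcirc c)$ and the five lines occurring in the equality (three through $a$, the line through $b,c$, and the line through $a\circledcirc b,a\circledcirc c$). *)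

(* Defs.v *)
From mathcomp Require Import all_boot all_algebra.
From mathcomp Require Import boolp classical_sets functions cardinality.

Set Implicit Arguments.
Unset Strict Implicit.
Unset Printing Implicit Defensive.

Import GRing.Theory.

Local Open Scope classical_set_scope.
Local Open Scope card_scope.

(* The point set is an arbitrary type, not assumed finite. *)
Record psts := Psts {
  point :> Type;
  line : set (set point);
  line_card3 : forall l, line l -> l #= `I_3;
  line_inj : forall (k l : set point) (p q : point), p <> q ->
    line k -> line l -> k p -> k q -> l p -> l q -> k = l }.

Lemma card3P T (l : set T) :
  l #= `I_3 <->
  exists a b c, [/\ a <> b, a <> c, b <> c & l = [set a; b; c]].
Proof.
split=> [/card_set_bijP[f [fl finj fsurj]]|[a [b [c [ab ac bc ->]]]]].
  have /fsurj[a la fa] : `I_3 0 by [].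
  have /fsurj[b lb fb] : `I_3 1 by [].
  have /fsurj[c lc fc] : `I_3 2 by [].
  exists a, b, c; split; try congruence.
  apply/seteqP; split=> [x lx|x [[->|->]|->]] //=.
  have := fl _ lx; case Ex: (f x) => [|[|[|//]]] _.
  - by left; left; apply: finj; rewrite ?inE// Ex fa.
  - by left; right; apply: finj; rewrite ?inE// Ex fb.
  - by right; apply: finj; rewrite ?inE// Ex fc.
pose f x : nat := if `[< x = a >] then 0 else if `[< x = b >] then 1 else 2.
have fa : f a = 0 by rewrite /f asboolT.
have fb : f b = 1 by rewrite /f asboolF ?asboolT// => /esym.
have fc : f c = 2 by rewrite /f !asboolF// => /esym.
apply/card_set_bijP; exists f; split.
- by move=> x [[->|->]|->]; rewrite /= ?fa ?fb ?fc.
- by move=> x y; rewrite !inE => -[[->|->]|->] [[->|->]|->]; rewrite ?fa ?fb ?fc.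
- case=> [|[|[|//]]] _; [exists a|exists b|exists c] => //=; tauto.
Qed.

Lemma set3_rot T (a b c : T) : [set a; b; c] = [set b; c; a].
Proof. by apply/seteqP; split=> x /=; tauto. Qed.

Lemma set3_swap T (a b c : T) : [set a; b; c] = [set b; a; c].
Proof. by apply/seteqP; split=> x /=; tauto. Qed.

Lemma set3_flip T (a b c : T) : [set a; b; c] = [set a; c; b].
Proof. by apply/seteqP; split=> x /=; tauto. Qed.

Lemma line_neq (M : psts) (a b c : M) :
  line [set a; b; c] -> [/\ a <> b, a <> c & b <> c].
Proof.
move=> /line_card3/card3P[x [y [z [xy xz yz]]]] E.
have Ex : [set a; b; c] x by rewrite E /=; tauto.
have Ey : [set a; b; c] y by rewrite E /=; tauto.
have Ez : [set a; b; c] z by rewrite E /=; tauto.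
by move: Ex Ey Ez => /= -[[]|] Ex [[]|] Ey [[]|] Ez; subst; split; congruence.
Qed.

Lemma line_third_inj (M : psts) (p q r s : M) :
  line [set p; q; r] -> line [set p; q; s] -> r = s.
Proof.
move=> lr ls; have [pq pr qr] := line_neq lr.
have E : [set p; q; r] = [set p; q; s].
  by apply: (line_inj pq) => //=; tauto.
have : [set p; q; s] r by rewrite -E /=; tauto.
by case=> [[]|] // /esym.
Qed.

Section Weave.
Variables (M : psts) (m : nat) (m_ge3 : 3 <= m).

Definition weave_line : set (set (M * 'Z_m)) :=
  [set l | exists (a b c : M) (i : 'Z_m),
     line [set a; b; c] /\ l = [set (a, i); (b, i); (c, (i + 1)%R)]].

Lemma weave_shift1 (i : 'Z_m) : (i + 1)%R <> i.
Proof. by move/(canRL (addKr i)); rewrite addNr => /eqP; rewrite oner_eq0. Qed.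

Lemma weave_shift2 (i : 'Z_m) : (i + 1 + 1)%R <> i.
Proof.
case: m m_ge3 i => [|[|[|n]]] // _ i.
by rewrite -addrA => /(canRL (addKr i)); rewrite addNr => /(congr1 val).
Qed.

Lemma weave_card3 l : weave_line l -> l #= `I_3.
Proof.
move=> [a [b [c [i [labc ->]]]]]; have [ab ac bc] := line_neq labc.
by apply/card3P; exists (a, i), (b, i), (c, (i + 1)%R); split=> // -[].
Qed.

Definition weave_third_level (i j : 'Z_m) : 'Z_m :=
  if i == j then (i + 1)%R else if j == (i + 1)%R then i else j.

Lemma weave_line_through l (p q : M * 'Z_m) :
  p <> q -> weave_line l -> l p -> l q ->
  exists2 r : M, line [set p.1; q.1; r] &
    l = [set p; q; (r, weave_third_level p.2 q.2)].
Proof.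
rewrite /weave_third_level => pq [a [b [c [i [labc ->]]]]].
have /negPf s1 : (i + 1)%R != i by apply/eqP/weave_shift1.
have /negPf s2 : (i + 1 + 1)%R != i by apply/eqP/weave_shift2.
move=> /= -[[]|] Ep [[]|] Eq; subst p q => //=;
  rewrite ?eqxx ?s1 ?[i == _]eq_sym ?s1 ?s2.
- by exists c.
- by exists b; [rewrite set3_flip | exact: set3_flip].
- by exists c; [rewrite set3_swap | exact: set3_swap].
- by exists a; [rewrite -set3_rot | exact: set3_rot].
- by exists b; [rewrite set3_rot | rewrite [RHS]set3_rot].
- by exists a; [rewrite set3_rot set3_swap | rewrite [RHS]set3_rot [RHS]set3_swap].
Qed.

Lemma weave_line_inj (k l : set (M * 'Z_m)) (p q : M * 'Z_m) :
  p <> q -> weave_line k -> weave_line l -> k p -> k q -> l p -> l q -> k = l.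
Proof.
move=> pq wk wl kp kq lp lq.
have [r lr ->] := weave_line_through pq wk kp kq.
have [s ls ->] := weave_line_through pq wl lp lq.
by rewrite (line_third_inj lr ls).
Qed.

Definition weave : psts := Psts weave_card3 weave_line_inj.

End Weave.

Section Miter.
Variable M : psts.

(* Graph of the partial operation: [psts_op p q r] means that the operation is
   defined at (p, q) and has value r. *)
Definition psts_op (p q r : M) : Prop :=
  (p = q /\ r = p) \/ line [set p; q; r].

Lemma psts_op_inj (p q r s : M) : psts_op p q r -> psts_op p q s -> r = s.
Proof.
case=> [[<- ->]|lr] [[E ->]|ls] //.
- by have [] := line_neq ls.
- by have [] := line_neq lr.
- exact: line_third_inj lr ls.
Qed.

Definition collinear (p q : M) : Prop := exists l, [/\ line l, l p & l q].

Definition triangle (a b c : M) : Prop :=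
  [/\ [/\ a <> b, a <> c & b <> c],
      [/\ collinear a b, collinear a c & collinear b c]
    & ~ exists l, [/\ line l, l a, l b & l c]].

(* P and L are the point set and the line set of the miter configuration with
   center a determined by the triangle {a, b, c}. *)
Definition miter_at (a b c : M) (P : set M) (L : set (set M)) : Prop :=
  triangle a b c /\
  exists ab ac bc d : M,
    [/\ [/\ psts_op a b ab, psts_op a c ac & psts_op b c bc],
        psts_op a bc d, psts_op ab ac d,
        P = [set a; b; c; ab; ac; bc; d]
      & L = [set [set a; b; ab]; [set a; c; ac]; [set a; bc; d];
                 [set b; c; bc]; [set ab; ac; d]]].

Definition miter_configuration (P : set M) (L : set (set M)) : Prop :=
  exists a b c : M, miter_at a b c P L.

End Miter.

(* Main.v *)
(** A line of the weaved configuration has levels u, u, u+1 in some order.  When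
    3 = 0 in C_m, the levels of a line thus add up to 1, and substituting these
    relations along the five lines of a miter configuration yields 1 = 0.  When
    3 <> 0, expressing the levels of the seven points relative to that of the
    center always leads to n = 0 in C_m for some n in {1, 2, 3}. *)

Require Import Defs.
From mathcomp Require Import all_boot all_algebra.
From mathcomp Require Import boolp classical_sets functions cardinality.
From mathcomp Require Import ring.

Set Implicit Arguments.
Unset Strict Implicit.
Unset Printing Implicit Defensive.

Import GRing.Theory.

Definition line_levels (R : comNzRingType) (x y z : R) : Prop :=
  [\/ x = y /\ z = (x + 1)%R, x = z /\ y = (x + 1)%R | y = z /\ x = (y + 1)%R].

Lemma line_levels_char3 (R : comNzRingType) (x y z : R) :
  (3%:R = 0 :> R)%R -> line_levels x y z -> z = (1 - x - y)%R.
Proof.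
move=> e3; have e (u v w : R) : (w - u = v * 3%:R)%R -> w = u.
  by rewrite e3 mulr0 => /eqP; rewrite subr_eq0 => /eqP.
(* The multiplier [v] is the repeated level u: the sum of u, u and u + 1 exceeds 1 by 3u. *)
by case=> -[-> ->]; [apply: (e _ y)|apply: (e _ z)|apply: (e _ z)]; ring.
Qed.

Lemma no_miter_levels_char3 (R : comNzRingType) (a b c ab ac bc d : R) :
  (3%:R = 0 :> R)%R ->
  line_levels a b ab -> line_levels a c ac -> line_levels b c bc ->
  line_levels a bc d -> line_levels ab ac d -> False.
Proof.
move=> e3; do 4![move=> /(line_levels_char3 e3)->].
move=> /(line_levels_char3 e3)/eqP; rewrite -subr_eq0 => /eqP e.
suff /eqP : (1 = 0 :> R)%R by rewrite oner_eq0.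
(* The two expressions obtained for the level [d] differ by 1 - 3a. *)
by rewrite -e -[LHS]subr0 -[X in (_ - X)%R](mulr0 a) -e3; ring.
Qed.

(* Refutes a context with an equation L = R such that L - R is the integer
   +-1, +-2 or +-3. *)
Ltac level_absurd n1 n2 n3 :=
  match goal with H : ?l = ?r |- _ =>
    let e := fresh in
    have e : (l - r = 0)%R by [apply/eqP; rewrite subr_eq0; apply/eqP; exact: H];
    solve [apply: n1; rewrite -e; ring | apply: n2; rewrite -e; ring
          | apply: n3; rewrite -e; ring
          | apply: n1; rewrite -oppr0 -e; ring
          | apply: n2; rewrite -oppr0 -e; ring
          | apply: n3; rewrite -oppr0 -e; ring ]
  end.

Lemma no_miter_levels (R : comNzRingType) (a b c ab ac bc d : R) :
  (2%:R <> 0 :> R)%R ->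
  line_levels a b ab -> line_levels a c ac -> line_levels b c bc ->
  line_levels a bc d -> line_levels ab ac d -> False.
Proof.
move=> n2; have n1 : (1%:R <> 0 :> R)%R by apply/eqP; rewrite oner_eq0.
(* As 2 is nonzero, the sides of the triangle admit vertex levels i, i + 1, i + 2 exactly when 3 =
   0; that case is left to the sum argument. *)
have [e3|n3] := pselect (3%:R = 0 :> R)%R; first exact: no_miter_levels_char3.
by case=> -[? ?]; case=> -[? ?]; case=> -[? ?]; subst; try level_absurd n1 n2 n3;
   case=> -[? ?]; subst; try level_absurd n1 n2 n3;
   case=> -[? ?]; subst; level_absurd n1 n2 n3.
Qed.

Lemma weave_line_levels (M : psts) (m : nat) (m_ge3 : (3 <= m)%N)
    (p q r : weave M m_ge3) :
  line [set p; q; r]%classic -> line_levels p.2 q.2 r.2.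
Proof.
move=> lpqr; have [pq pr qr] := line_neq lpqr.
case: lpqr => a [b [c [i [_ E]]]].
(* Only an equality of unordered sets is given, so each point is matched by membership; repeated
   matches contradict distinctness. *)
have Ep : [set p; q; r]%classic p by rewrite /=; tauto.
have Eq : [set p; q; r]%classic q by rewrite /=; tauto.
have Er : [set p; q; r]%classic r by rewrite /=; tauto.
rewrite !E /= in Ep Eq Er; rewrite /line_levels.
by case: Ep => [[]|] Ep; case: Eq => [[]|] Eq; case: Er => [[]|] Er;
   subst => //=; (constructor 1 + constructor 2 + constructor 3).
Qed.

(** Excludes the idempotent branch of [psts_op]. If [bc] were [a], the center would lie on the line
    through [b] and [c]; if [ab] were [ac], two lines through [a] would share a second point and
    coincide. Either way the triangle is collinear. *)
Lemma miter_lines (M : psts) (a b c ab ac bc d : M) :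
  triangle a b c ->
  psts_op a b ab -> psts_op a c ac -> psts_op b c bc ->
  psts_op a bc d -> psts_op ab ac d ->
  [/\ line [set a; b; ab], line [set a; c; ac], line [set b; c; bc],
      line [set a; bc; d] & line [set ab; ac; d]]%classic.
Proof.
move=> [[nab nac nbc] _ nl] [[//]|l1] [[//]|l2] [[//]|l3] o4 o5.
split=> //.
- case: o4 => [[e _]|//]; subst bc; case: nl.
  by exists [set b; c; a]%classic; split=> //=; tauto.
- case: o5 => [[e _]|//]; subst ac; case: nl.
  have [_ na _] := line_neq l1.
  have E : [set a; c; ab]%classic = [set a; b; ab]%classic.
    by apply: (line_inj na l2 l1) => /=; tauto.
  have : [set a; b; ab]%classic c by rewrite -E /=; tauto.
  by exists [set a; b; ab]%classic; split=> //=; tauto.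
Qed.

Theorem proposition2p13 (M : psts) (m : nat) (m_ge3 : (3 <= m)%N) :
  ~ exists (P : set (weave M m_ge3)) (L : set (set (weave M m_ge3))),
      miter_configuration P L.
Proof.
move=> [P [L [a [b [c [tabc [ab [ac [bc [d [[o1 o2 o3] o4 o5 _ _]]]]]]]]]]].
have [l1 l2 l3 l4 l5] := miter_lines tabc o1 o2 o3 o4 o5.
apply: (@no_miter_levels 'Z_m a.2 b.2 c.2 ab.2 ac.2 bc.2 d.2);
  try exact: weave_line_levels.
(* If 2 = 0, two shifts would bring level 0 back to itself, impossible for [m] at least 3. *)
by move=> e; apply: (@weave_shift2 _ m_ge3 0%R); rewrite -[RHS]e; ring.
Qed.
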